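(* For any $n\geq 1$, the map $\phi:\mathsf{CC}(n)\rightarrow\mathsf{TID}(n)$ from the set of cubic coordinates of size $n$ to the set of Tamari interval diagrams of size $n$ is a bijection.
   Context: For integers $i,j$, $[i,j]=\{i,i+1,\dots,j\}$ and $[i]=[1,i]$. The $i$-th letter of a word $u$ is $u_i$. A Tamari diagram of size $n$ is a word $u$ of length $n$ on $\mathbb{N}=\{0,1,2,\dots\}$ such that (i) $0\leq u_i\leq n-i$ for all $i\in[n]$, and (ii) $u_{i+j}\leq u_i-j$ for all $i\in[n]$ and $j\in[0,u_i]$. A dual Tamari diagram of size $n$ is a word $v$ of length $n$ on $\mathbb{N}$ such that (i) $0\leq v_i\leq i-1$ for all $i\in[n]$, and (ii) $v_{i-j}\leq v_i-j$ for all $i\in[n]$ and $j\in[0,v_i]$. They are compatible if there are no $i,j$ with $1\leq i<j\leq n$ such that $u_i\geq j-i$ and $v_j\geq j-i$. A Tamari interval diagram of size $n$ is a pair $(u,v)$ consisting of a Tamari diagram $u$ and a dual Tamari diagram $v$, both of size $n$, that are compatible; $\mathsf{TID}(n)$ is the set of these. A cubic coordinate of size $n$ is an $(n-1)$-tuple $c$ of integers such that there is $(u,v)\in\mathsf{TID}(n)$ with $c=(u_1-v_2,u_2-v_3,\dots,u_{n-1}-v_n)$; $\mathsf{CC}(n)$ is the set of these. The map $\phi$ sends an $(n-1)$-tuple $c$ of integers to the pair $(u,v)$ of words of length $n$ on $\mathbb{N}$ defined by $u_n=0$, $u_i=\max(c_i,0)$ for $i\in[n-1]$, $v_1=0$,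 and $v_i=|\min(c_{i-1},0)|$ for $2\leq i\leq n$. *)

(* Defs.v *)
From mathcomp Require Import all_boot all_order all_algebra.
From mathcomp Require Import classical_sets functions.

Set Implicit Arguments.
Unset Strict Implicit.
Unset Printing Implicit Defensive.

(* Letters are numbered from 1. The default x0 (for i > size s) and the case
   i = 0 are out of range and do not influence the definitions below. *)
Definition letter (T : Type) (x0 : T) (s : seq T) (i : nat) : T :=
  nth x0 s i.-1.

Notation "s .[l i ]" := (letter 0%N s i) (at level 2, i at level 200,
  left associativity, format "s .[l  i ]") : nat_scope.

Local Open Scope nat_scope.

(* The truncated subtractions below never truncate: i <= n in the first
   condition, j <= u_i (resp. j <= v_i <= i - 1) in the second. *)
Definition tamari_diagram (n : nat) (u : n.-tuple nat) : Prop :=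
  (forall i, 1 <= i <= n -> 0 <= u.[l i] <= n - i) /\
  (forall i j, 1 <= i <= n -> 0 <= j <= u.[l i] ->
     u.[l i + j] <= u.[l i] - j).

Definition dual_tamari_diagram (n : nat) (v : n.-tuple nat) : Prop :=
  (forall i, 1 <= i <= n -> 0 <= v.[l i] <= i - 1) /\
  (forall i j, 1 <= i <= n -> 0 <= j <= v.[l i] ->
     v.[l i - j] <= v.[l i] - j).

Definition compatible (n : nat) (u v : n.-tuple nat) : Prop :=
  ~ exists i j, [/\ 1 <= i, i < j, j <= n, u.[l i] >= j - i & v.[l j] >= j - i].

Definition TID (n : nat) : set (n.-tuple nat * n.-tuple nat) :=
  fun uv => [/\ tamari_diagram uv.1, dual_tamari_diagram uv.2
              & compatible uv.1 uv.2].

(* The tuple (u_1 - v_2, ..., u_{n-1} - v_n); the bound index k is 0-based. *)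
Definition diagram_diff (n : nat) (u v : n.-tuple nat) : n.-1.-tuple int :=
  [tuple ((u.[l k.+1])%:Z - (v.[l k.+2])%:Z)%R | k < n.-1].

Definition CC (n : nat) : set (n.-1.-tuple int) :=
  fun c => exists uv, TID uv /\ c = diagram_diff uv.1 uv.2.

(* The bound index k is 0-based and i = k + 1. The codomain of absz is nat: it
   is the plain cast on max(c_i, 0) >= 0 and |.| on min(c_{i-1}, 0). *)
Definition phi (n : nat) (c : n.-1.-tuple int) : n.-tuple nat * n.-tuple nat :=
  ([tuple (let i := k.+1 in
           if i == n then 0 else absz (Num.max (letter 0%R c i) 0%R)) | k < n],
   [tuple (let i := k.+1 in
           if i == 1 then 0 else absz (Num.min (letter 0%R c i.-1) 0%R)) | k < n]).

Arguments TID n : clear implicits.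
Arguments CC n : clear implicits.
Arguments phi n c : clear implicits.

(* Main.v *)
Require Import Defs.
From mathcomp Require Import all_boot all_order all_algebra.
From mathcomp Require Import classical_sets functions.
From mathcomp Require Import zify.

(** Write [diff] for the map [(u, v) |-> (u_1 - v_2, ..., u_{n-1} - v_n)]. By
    definition the cubic coordinates are the image of the Tamari interval
    diagrams under [diff], so everything follows once [phi] is known to be a left
    inverse of [diff] on these diagrams ([phi_diagram_diff]): [phi] then maps
    the image of [diff] back onto the diagrams, bijectively.

    The left inverse exists because compatibility, applied to the adjacent
    indices [i] and [i + 1], forbids [u_i] and [v_{i+1}] from being both positive
    ([compatible_adjacent]). Hence [u_i - v_{i+1}] determines both letters: they
    are its positive and its negative part. The two letters that [diff] ignores,
    [u_n] and [v_1], vanish in every diagram, by the bounds in condition (i). *)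

Lemma letter_diagram_diff (n : nat) (u v : n.-tuple nat) (i : nat) :
  (1 <= i < n)%N ->
  letter 0%R (diagram_diff u v) i
    = ((u.[l i])%:Z - (v.[l i.+1])%:Z)%R.
Proof.
case: i => [|i] //= lt_in; have lt_in1 : (i < n.-1)%N by lia.
have := tnth_nth 0%R (diagram_diff u v) (Ordinal lt_in1).
by rewrite tnth_mktuple => ->.
Qed.

(** Two positive letters [u_i] and [v_{i+1}] are both at least the distance
    [(i + 1) - i = 1] between their positions, which is the pattern that
    compatibility excludes. *)
Lemma compatible_adjacent (n : nat) (u v : n.-tuple nat) (i : nat) :
  compatible u v -> (1 <= i < n)%N -> u.[l i] = 0 \/ v.[l i.+1] = 0.
Proof.
move=> compat_uv /andP[i_gt0 lt_in].
case: (posnP (u.[l i])) => [|u_gt0]; first by left.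
case: (posnP (v.[l i.+1])) => [|v_gt0]; first by right.
by case: compat_uv; exists i, i.+1; rewrite subSnn.
Qed.

(** When one of two naturals [a] and [b] is zero, [max (a - b, 0) = a] and
    [|min (a - b, 0)| = b]; this recovers every letter that occurs in a
    difference. *)
Lemma phi_diagram_diff (n : nat) (uv : n.-tuple nat * n.-tuple nat) :
  TID n uv -> phi n (diagram_diff uv.1 uv.2) = uv.
Proof.
case: uv => u v [[u_le _] [v_le _] compat_uv]; rewrite /= in u_le v_le compat_uv *.
congr pair; apply: eq_from_tnth => k; rewrite tnth_mktuple /=.
- have -> : tnth u k = u.[l k.+1] by rewrite (tnth_nth 0).
  case: eqP => [k1n | k1_neq_n]; first by have := u_le k.+1; lia.
  have lt_k1n : (1 <= k.+1 < n)%N by have := ltn_ord k; lia.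
  rewrite letter_diagram_diff //.
  by case: (compatible_adjacent _ _ _ _ compat_uv lt_k1n); lia.
- have -> : tnth v k = v.[l k.+1] by rewrite (tnth_nth 0).
  case: eqP => [k1 | k1_neq_1];
    first by have := v_le k.+1; have := ltn_ord k; lia.
  have k_range : (1 <= k < n)%N by have := ltn_ord k; lia.
  rewrite letter_diagram_diff //.
  by case: (compatible_adjacent _ _ _ _ compat_uv k_range); lia.
Qed.

Theorem theorem2p3p1 (n : nat) (hn : (1 <= n)%N) :
  set_bij (CC n) (TID n) (phi n).
Proof.
split.
- by move=> _ [uv [uv_TID ->]]; rewrite phi_diagram_diff.
- move=> c c' /set_mem[uv [uv_TID ->]] /set_mem[uv' [uv'_TID ->]].
  by rewrite !phi_diagram_diff // => ->.
- move=> uv uv_TID; exists (diagram_diff uv.1 uv.2); last exact: phi_diagram_diff.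
  by exists uv.
Qed.
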